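(* For the gray M1 moment system of radiative transfer, the invariant region $$G=\big\{\mathbf u=(E_r,\boldsymbol{\mathcal F}_r)^\top\in\mathbb R^4:\ E_r-\|\boldsymbol{\mathcal F}_r\|\ge 0\big\}\qquad(E_r\in\mathbb R,\ \boldsymbol{\mathcal F}_r\in\mathbb R^3)$$ has the GQL representation $$G_*=\big\{\mathbf u=(E_r,\boldsymbol{\mathcal F}_r)^\top\in\mathbb R^4:\ E_r-\boldsymbol{\mathcal F}_r\cdot\boldsymbol\theta_*\ge 0\quad\forall\,\boldsymbol\theta_*\in\mathbb S_1(\mathbf 0)\big\},$$ where $\mathbb S_1(\mathbf 0):=\{\boldsymbol x\in\mathbb R^3:\ \|\boldsymbol x\|=1\}$; that is, $G=G_*$.
   Context: A GQL (equivalent linear) representation of a set is an equal set described by constraints that are all affine in $\mathbf u$, possibly quantified over auxiliary parameters independent of $\mathbf u$. $E_r$ is the radiation energy, $\boldsymbol{\mathcal F}_r$ the radiation energy flux, and $\|\cdot\|$ the Euclidean norm. *)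

(* Defs.v *)
From HB Require Import structures.
From mathcomp Require Import all_boot all_order all_algebra.
From mathcomp Require Import all_classical all_reals.

Set Implicit Arguments.
Unset Strict Implicit.
Unset Printing Implicit Defensive.

Import Order.TTheory GRing.Theory Num.Theory.

Local Open Scope classical_set_scope.
Local Open Scope ring_scope.

(* The Euclidean norm is defined here because the norm `|x| that
   MathComp-Analysis puts on matrices is the sup norm. *)

Definition dot (R : realType) (n : nat) (x y : 'cV[R]_n) : R :=
  \sum_(i < n) x i 0 * y i 0.

Definition enorm (R : realType) (n : nat) (x : 'cV[R]_n) : R :=
  Num.sqrt (dot x x).

Definition usphere (R : realType) (n : nat) : set 'cV[R]_n :=
  [set x | enorm x = 1].

(* A state (E_r, F_r)^T is a column vector of R^(1+3), i.e. of R^4. *)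

Definition Er (R : realType) (u : 'cV[R]_(1 + 3)) : R := usubmx u 0 0.

Definition Fr (R : realType) (u : 'cV[R]_(1 + 3)) : 'cV[R]_3 := dsubmx u.

Definition M1_region (R : realType) : set 'cV[R]_(1 + 3) :=
  [set u | 0 <= Er u - enorm (Fr u)].

Definition M1_region_star (R : realType) : set 'cV[R]_(1 + 3) :=
  [set u | forall theta, usphere theta -> 0 <= Er u - dot (Fr u) theta].

Definition affine_fun (R : realType) (V : lmodType R) (f : V -> R) : Prop :=
  exists (l : {scalar V}) (b : R), forall u, f u = l u + b.

(* Each parameter p in the u-independent set Theta contributes one inequality
   0 <= phi p u, or 0 < phi p u when strict p holds. An affine equation is a
   pair of opposite inequalities. *)
Definition affinely_constrained (R : realType) (V : lmodType R) (A : set V)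
    : Prop :=
  exists (P : Type) (Theta : set P) (strict : P -> bool) (phi : P -> V -> R),
    (forall p, Theta p -> affine_fun (phi p)) /\
    A = [set u | forall p, Theta p ->
           if strict p then 0 < phi p u else 0 <= phi p u].

Definition GQL_representation (R : realType) (V : lmodType R)
    (G Gstar : set V) : Prop :=
  G = Gstar /\ affinely_constrained Gstar.

(* Main.v *)
Require Import Defs.
From HB Require Import structures.
From mathcomp Require Import all_boot all_order all_algebra.
From mathcomp Require Import all_classical all_reals.

(** The Euclidean norm is the support function of the unit sphere: [enorm x] is
    the maximum of [dot x theta] over unit vectors [theta]. It is an upper
    bound by Cauchy-Schwarz ([dot_usphere_le]), and it is attained because [x]
    lies on the ray through some unit vector ([polar_decomposition]). Hence
    the inequality [enorm F <= E] is equivalent to the family of inequalities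
    [dot F theta <= E], and for a fixed [theta] each of these is linear in
    the state [(E, F)]. *)

Set Implicit Arguments.
Unset Strict Implicit.
Unset Printing Implicit Defensive.

Import Order.TTheory GRing.Theory Num.Theory.

Local Open Scope classical_set_scope.
Local Open Scope ring_scope.

Section EuclideanSpace.
Variables (R : realType) (n : nat).
Implicit Types (x y t : 'cV[R]_n) (a : R).

Lemma dotC x y : dot x y = dot y x.
Proof. by apply: eq_bigr => i _; rewrite mulrC. Qed.

Lemma dotDl x y t : dot (x + y) t = dot x t + dot y t.
Proof. by rewrite /dot -big_split; apply: eq_bigr => i _; rewrite mxE mulrDl. Qed.

Lemma dotZl a x y : dot (a *: x) y = a * dot x y.
Proof. by rewrite /dot mulr_sumr; apply: eq_bigr => i _; rewrite mxE mulrA. Qed.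

Lemma dotxx_ge0 x : 0 <= dot x x.
Proof. by apply: sumr_ge0 => i _; rewrite -expr2 sqr_ge0. Qed.

Lemma dotxx_eq0 x : dot x x = 0 -> x = 0.
Proof.
move=> /eqP; rewrite psumr_eq0 => [/allP x0|i _]; last by rewrite -expr2 sqr_ge0.
apply/colP => i; rewrite mxE; apply/eqP.
by have := x0 i (mem_index_enum _); rewrite /= mulf_eq0 orbb.
Qed.

Lemma sqr_enorm x : enorm x ^+ 2 = dot x x.
Proof. by rewrite sqr_sqrtr ?dotxx_ge0. Qed.

Lemma enorm_eq0 x : enorm x = 0 -> x = 0.
Proof. by move=> x0; apply: dotxx_eq0; rewrite -sqr_enorm x0 expr0n. Qed.

Lemma dot_usphere t : usphere t -> dot t t = 1.
Proof. by rewrite -sqr_enorm => ->; rewrite expr1n. Qed.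

(** Cauchy-Schwarz against a unit vector: the component of [x] orthogonal to
    [t] has squared norm [dot x x - dot x t ^+ 2], which is nonnegative. *)
Lemma dot_usphere_le x t : usphere t -> dot x t <= enorm x.
Proof.
move=> /dot_usphere tt1; apply: le_trans (ler_norm _) _.
rewrite -sqrtr_sqr ler_wsqrtr // -subr_ge0.
have := dotxx_ge0 (x + - dot x t *: t).
rewrite dotDl dotZl [dot x (_ + _)]dotC [dot t (_ + _)]dotC !dotDl !dotZl tt1.
by rewrite mulr1 subrr mulr0 addr0 (dotC t x) mulNr -expr2.
Qed.

End EuclideanSpace.

(** This supplies the vector at which [dot x] attains its maximum over the
    sphere. The dimension is positive because [R^0] has an empty sphere. *)
Lemma polar_decomposition (R : realType) (n : nat) (x : 'cV[R]_n.+1) :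
  exists2 t, usphere t & x = enorm x *: t.
Proof.
have [/eqP x0|x_neq0] := boolP (enorm x == 0).
  (* The zero vector lies on every ray, so any unit vector serves. *)
  exists (delta_mx 0 0); last by rewrite x0 scale0r; apply: enorm_eq0.
  rewrite /usphere /= /enorm /dot (bigD1 ord0) //= big1 => [|i /negbTE i0].
    by rewrite mxE !eqxx mulr1 addr0 sqrtr1.
  by rewrite mxE i0 mul0r.
exists ((enorm x)^-1 *: x); last by rewrite scalerA divff // scale1r.
rewrite /usphere /= /enorm dotZl dotC dotZl -/(enorm x) -sqr_enorm.
by rewrite expr2 mulKf // mulVf // sqrtr1.
Qed.

(** Duality: it trades a bound that is nonlinear in [x] for bounds that are
    linear in [x], over an index set that does not depend on [x]. The unit
    vector on the ray through [x] is the one that makes the bound sharp. *)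
Lemma enorm_leP (R : realType) (n : nat) (x : 'cV[R]_n.+1) (e : R) :
  enorm x <= e <-> forall t, usphere t -> dot x t <= e.
Proof.
split=> [xe t t1|xe]; first exact: le_trans (dot_usphere_le x t1) xe.
have [t t1 xE] := polar_decomposition x.
by have := xe t t1; rewrite {1}xE dotZl dot_usphere // mulr1.
Qed.

Definition M1_form (R : realType) (t : 'cV[R]_3) (u : 'cV[R]_(1 + 3)) : R :=
  Er u - dot (Fr u) t.

Lemma M1_form_is_scalar (R : realType) (t : 'cV[R]_3) : scalar (M1_form t).
Proof.
move=> a u v; rewrite /M1_form /Er /Fr !linearP /= dotDl dotZl !mxE.
by rewrite mulrBr opprD addrACA.
Qed.

HB.instance Definition _ (R : realType) (t : 'cV[R]_3) :=
  GRing.isLinear.Build R 'cV[R]_(1 + 3) R *%R (M1_form t) (M1_form_is_scalar t).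

Theorem theorem4p8 (R : realType) :
  GQL_representation (@M1_region R) (@M1_region_star R).
Proof.
split.
  apply/seteqP; split=> u /=; rewrite /M1_region /M1_region_star /= subr_ge0.
    by move=> /enorm_leP Fu t t1; rewrite subr_ge0 Fu.
  by move=> Fu; apply/enorm_leP => t t1; rewrite -subr_ge0 Fu.
exists 'cV[R]_3, (@usphere R 3), (fun=> false), (@M1_form R); split=> // t _.
by exists (M1_form t), 0 => u; rewrite addr0.
Qed.
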